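(* Let $X$ be a nonempty finite or countably infinite set and let $\alpha=(\alpha_{xy})_{x,y\in X}$ be a matrix with nonnegative real entries. Let $\Lambda\subseteq X$, and let $c=(c_x)_{x\in X}\ge 0$ and $w=(w_x)_{x\in X}\ge 0$ be (real-valued) vectors satisfying (a) $c(I_\Lambda\alpha I_\Lambda)^kw<\infty$ for all $k\ge 0$, and (b) $\lim_{k\to\infty}c(I_\Lambda\alpha I_\Lambda)^kw=0$. Then it is possible to find a sequence of sites $x_1,x_2,\ldots\in\Lambda$ and a sequence of numbers $\epsilon_1,\epsilon_2,\ldots\in(0,1]$ such that $$\lim_{n\to\infty}c\,\beta_{\epsilon_1\delta_{x_1}}\cdots\beta_{\epsilon_n\delta_{x_n}}I_\Lambda w=0 .$$
   Context: $c$ is a row vector and $w$ a column vector; products are computed in $[0,+\infty]$ with $0\cdot\infty=0$. For $f\colon X\to\mathbb R$, $I_f$ is the diagonal matrix $(I_f)_{xy}=f(x)\delta_{xy}$ (where $\delta_{xy}$ is the Kronecker delta); $I_\Lambda=I_{\chi_\Lambda}$ with $\chi_\Lambda$ the indicator function of $\Lambda$. A $0$-th power of a matrix is the identity matrix. For $f\colon X\to[0,1]$ the cleaning operator is $\beta_f=I_{1-f}+I_f\alpha$. $\delta_x$ denotes the indicator function of $\{x\}$. No subinvariance condition (such as $\alpha w\le w$) is assumed.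
   Formalization: The set Λ is assumed nonempty: for Λ = ∅ conditions (a) and (b) can hold (e.g. c = w = 0), but no sequence of sites in Λ exists, so the claim as literally stated fails in that degenerate case. *)

(* Defs.v *)
From HB Require Import structures.
From mathcomp Require Import all_boot all_order all_algebra.
From mathcomp Require Import all_classical all_reals all_analysis.

Set Implicit Arguments.
Unset Strict Implicit.
Unset Printing Implicit Defensive.
Import Order.TTheory GRing.Theory Num.Theory.
Import numFieldNormedType.Exports.

Local Open Scope classical_set_scope.
Local Open Scope ring_scope.
Local Open Scope ereal_scope.

(* Vectors and matrices over a countable index set X, with entries in \bar R.
   They are only meant to be used with entries in [0, +oo]: there [\esum] is
   the usual unconditional sum, the products below are associative (Tonelli),
   and 0 * +oo = 0 is the convention of the library. *)
Definition evec (R : realType) (X : countType) := X -> \bar R.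
Definition emx (R : realType) (X : countType) := X -> X -> \bar R.

Definition evec_of (R : realType) (X : countType) (v : X -> R) : evec R X :=
  fun x => (v x)%:E.

Definition emx_of (R : realType) (X : countType) (A : X -> X -> R) : emx R X :=
  fun x y => (A x y)%:E.

Definition addemx (R : realType) (X : countType) (A B : emx R X) : emx R X :=
  fun x y => A x y + B x y.

Definition mulemx (R : realType) (X : countType) (A B : emx R X) : emx R X :=
  fun x y => \esum_(z in [set: X]) (A x z * B z y).

Definition diagemx (R : realType) (X : countType) (f : X -> R) : emx R X :=
  fun x y => (f x * (x == y)%:R)%:E.

Definition idemx (R : realType) (X : countType) : emx R X :=
  diagemx (fun _ : X => 1%R : R).

Arguments idemx {R X}.

Definition expemx (R : realType) (X : countType) (A : emx R X) (k : nat) :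
    emx R X :=
  iter k (mulemx A) idemx.

Definition mulvemx (R : realType) (X : countType) (c : evec R X) (A : emx R X) :
    evec R X :=
  fun y => \esum_(x in [set: X]) (c x * A x y).

Definition dotev (R : realType) (X : countType) (c w : evec R X) : \bar R :=
  \esum_(x in [set: X]) (c x * w x).

(* The number c A w, for a row vector c and a column vector w. *)
Definition sandwich (R : realType) (X : countType)
    (c : X -> R) (A : emx R X) (w : X -> R) : \bar R :=
  dotev (mulvemx (evec_of c) A) (evec_of w).

Definition restr (R : realType) (X : countType) (L : set X) : emx R X :=
  diagemx (\1_L : X -> R).

Arguments restr {R X} L.

Definition cleaning (R : realType) (X : countType)
    (alpha : X -> X -> R) (f : X -> R) : emx R X :=
  addemx (diagemx (fun x => 1 - f x)%R) (mulemx (diagemx f) (emx_of alpha)).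

(* Main.v *)
Require Import Defs.
From HB Require Import structures.
From mathcomp Require Import all_boot all_order all_algebra.
From mathcomp Require Import all_classical all_reals all_analysis.
From mathcomp Require Import ring lra.

(** Write [A] for the restriction of [alpha] to [L] and think of [c] as a mass
    distribution, measured by its weight [c w]. Cleaning a site [x] of [L] with
    proportion [eps] moves the amount [eps * c x] away from [x], along [alpha].
    Since [eps] is free in (0, 1], any amount between 0 and [c x] can be moved
    at [x], whatever has arrived there in the meantime
    ([cleans_amount]). Hence the mass [p] present at some moment on a
    finite set [s] of sites can be replaced by exactly its image under [alpha]:
    the sites of [s] are cleaned one after another, each time moving the amount
    [p x] and nothing that arrived later ([cleans_sweep]).

    Repeating this for [k] generations, with finite sets that exhaust each
    generation up to a small tail, turns [c] into [q' + p'], where [p'] is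
    dominated by [c A^k] and [q'] consists of [k] tails
    ([cleans_generations]). The final weight is small for large [k], because
    [c A^k w] tends to 0.

    A single small weight is not enough: the weight must stay small while the
    construction is repeated. The right quantity is therefore
    N(v) = sup_i (v A^i w), which involves the weights of all future
    generations. It controls the weights along the way, because each
    intermediate vector consists of tails, a part of one generation and
    the image of another part of it; and it can be made small at the
    end, because for a vector with finite weights [v A^i w] tending to 0 the
    tails are small uniformly in [i] ([vanishing_tail]). So from every such [v]
    a finite series of cleanings leads to some [v'] of the same kind
    with N(v') as small as desired, and meanwhile the weight never exceeds
    4 N(v) plus a small number ([cleans_phase]). Chaining such phases with
    bounds tending to 0 gives the infinite sequence ([cleaning_sequence]).

    Only the numbers [v A^i w] matter, so the argument is carried out with the
    column vectors [A^i w] restricted to [L], and matrices are eliminated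
    separately by means of Tonelli's theorem. *)

Set Implicit Arguments.
Unset Strict Implicit.
Unset Printing Implicit Defensive.
Import Order.TTheory GRing.Theory Num.Theory.
Import numFieldNormedType.Exports.

Local Open Scope classical_set_scope.
Local Open Scope ring_scope.

(** * Sums of extended nonnegative numbers *)

Section ExtendedSums.
Variables (R : realType) (X : choiceType).
Implicit Types (a : X -> \bar R) (s : seq X).

Lemma esum_only a t : (forall x, x != t -> a x = 0)%E -> (0 <= a t)%E ->
  \esum_(x in [set: X]) a x = a t.
Proof.
move=> at0 a0; rewrite (esumID [set t]); last first.
  by move=> x _; have [->|/at0->] := eqVneq x t.
rewrite !setTI esum_set1 // esum1 ?adde0 // => x xt.
by apply: at0; apply/eqP.
Qed.

(** The factor may be infinite: then both sides are 0 or [+oo] according to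
    whether [a] vanishes identically. *)
Lemma esumZ k a : (0 <= k)%E -> (forall x, 0 <= a x)%E ->
  \esum_(x in [set: X]) (k * a x)%E = (k * \esum_(x in [set: X]) a x)%E.
Proof.
have leZ (j : \bar R) (b : X -> \bar R) :
    (0 <= j)%E -> (forall x, 0 <= b x)%E ->
    (\esum_(x in [set: X]) (j * b x) <= j * \esum_(x in [set: X]) b x)%E.
  move=> j0 b0; apply: ge_ereal_sup => _ [F finF <-].
  rewrite -ge0_mule_fsumr //; apply: lee_wpmul2l => //.
  by apply: esum_ge; exists F.
move=> k0 a0; apply/eqP; rewrite eq_le leZ //=.
case: k k0 => [r||//] k0.
- have [->|rN0] := eqVneq r 0.
    by rewrite mul0e; apply: esum_ge0 => x _; rewrite mul0e.
  have r0 : 0 < r by rewrite lt_neqAle eq_sym rN0.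
  have ra0 x : (0 <= r%:E * a x)%E by apply: mule_ge0.
  have := leZ (r^-1)%:E _ _ ra0.
  rewrite lee_fin invr_ge0 (ltW r0) => /(_ isT).
  under eq_esum do rewrite muleA -EFinM mulVf // mul1e.
  move=> /(lee_wpmul2l k0); rewrite muleA -EFinM mulfV // mul1e.
  exact.
- have [a_eq0|/existsNP[t /eqP at0]] := pselect (forall x, a x = 0%E).
    rewrite [X in (_ * X)%E]esum1 ?mule0.
      by apply: esum_ge0 => x _; exact: mule_ge0.
    by move=> x _; exact: a_eq0.
  have atp : (0 < a t)%E by rewrite lt_neqAle eq_sym at0 a0.
  suff -> : \esum_(x in [set: X]) (+oo * a x)%E = +oo%E by rewrite leey.
  apply/eqP; rewrite -leye_eq; apply: esum_ge.
  exists [set t]; first by split.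
  by rewrite fsbig_set1 gt0_mulye.
Qed.

(** The finite set comes from the definition of the sum as a supremum over
    finite sets; the complementary sum is what remains of the total. *)
Lemma esum_tail a (e : R) : (forall x, 0 <= a x)%E ->
  (\esum_(x in [set: X]) a x < +oo)%E -> 0 < e ->
  exists s, (\esum_(x in [set: X]) (if x \in s then 0 else a x) <= e%:E)%E.
Proof.
move=> a0 afin e0.
have afn : \esum_(x in [set: X]) a x \is a fin_num.
  by rewrite ge0_fin_numE // esum_ge0.
have [_ [F [finF _] <-]] := ub_ereal_sup_adherent e0 afn.
rewrite -/(esum _ _) => ltF; exists (finmap.enum_fset (fset_set F)).
have sF : \esum_(x in F) a x = \sum_(x \in F) a x.
  by rewrite -esum_fset // set_mem_set.
have Ffn : \esum_(x in F) a x \is a fin_num.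
  rewrite ge0_fin_numE ?esum_ge0 //; apply: le_lt_trans afin.
  by rewrite sF; apply: esum_ge; exists F.
move: ltF; rewrite -sF (esumID F setT) // !setTI => /ltW.
rewrite leeBlDr // leeD2lE // [X in (X <= _)%E]esum_mkcond.
congr (_ <= _)%E; apply: eq_esum => x _.
have -> : (x \in finmap.enum_fset (fset_set F)) = (x \in F).
  exact: (in_fset_set finF x).
by rewrite in_setC; case: (x \in F).
Qed.

Lemma exchange_esum (Y : choiceType) (a : X -> Y -> \bar R) :
  (forall x y, 0 <= a x y)%E ->
  \esum_(x in [set: X]) \esum_(y in [set: Y]) a x y =
  \esum_(y in [set: Y]) \esum_(x in [set: X]) a x y.
Proof.
move=> a0; rewrite !esum_esum //.
rewrite (reindex_esum ([set: Y] `*`` (fun=> [set: X])) _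
  (fun z => (z.2, z.1))) //; split=> //=.
- by move=> [y1 x1] [y2 x2] /= _ _ [-> ->].
- by move=> [x y] _; exists (y, x).
Qed.

End ExtendedSums.

Lemma cvge0P (R : realType) (u : nat -> \bar R) : (forall n, 0 <= u n)%E ->
  u @ \oo --> 0%E <->
  (forall e : R, 0 < e -> exists N, forall n, (N <= n)%N -> (u n <= e%:E)%E).
Proof.
move=> u0; split=> [/fine_cvgP[[N1 _ fin] /cvgrPdist_le cvg] e e0|small].
  have [N2 _ leN2] := cvg e e0.
  exists (maxn N1 N2) => n; rewrite geq_max => /andP[n1 n2].
  have := leN2 n n2; rewrite /= sub0r normrN ger0_norm ?fine_ge0 //.
  by rewrite -lee_fin fineK //; exact: fin.
apply/fine_cvgP; split.
  have [N leN] := small 1 ltr01; exists N => // n /leN le1.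
  by rewrite ge0_fin_numE // (le_lt_trans le1) // ltry.
apply/cvgrPdist_le => e e0; have [N leN] := small e e0.
exists N => // n /leN le1; rewrite /= sub0r normrN ger0_norm ?fine_ge0 //.
by rewrite -lee_fin fineK // ge0_fin_numE // (le_lt_trans le1) // ltry.
Qed.

(** * Moving mass by cleanings *)

Section Cleaning.
Variables (R : realType) (X : countType) (alpha : X -> X -> R) (L : set X).
Hypothesis alpha_ge0 : forall x y, 0 <= alpha x y.
(* [h i] stands for the column vector [A^i w] restricted to [L], where [A] is
   the restriction of [alpha] to [L]. *)
Variable h : nat -> X -> \bar R.
Hypothesis h_ge0 : forall i x, (0 <= h i x)%E.
Hypothesis h_off : forall i x, ~ L x -> h i x = 0%E.
Hypothesis hS : forall i x, L x ->
  h i.+1 x = \esum_(y in [set: X]) ((alpha x y)%:E * h i y)%E.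

Implicit Types (v p q r : X -> R) (s : seq X) (B C : \bar R).

Definition weight v i : \bar R := \esum_(x in [set: X]) ((v x)%:E * h i x)%E.

Local Notation nonneg v := (forall x : X, 0 <= v x).

Definition outside s v : X -> R := fun x => if x \in s then 0 else v x.

(** The property of [c] that is passed on from one phase to the next. *)
Definition vanishing v := (forall i, weight v i < +oo)%E /\
  (weight v @ \oo --> 0%E).

(** The row vector obtained from [v] by the cleaning operator with proportion
    [a.2] at the site [a.1]. *)
Definition clean v (a : X * R) : X -> R := fun y =>
  (1 - a.2 * (y == a.1)%:R) * v y + a.2 * v a.1 * alpha a.1 y.

Definition legal (a : X * R) := L a.1 /\ 0 < a.2 <= 1.

(** [C] bounds the weight of every vector met on the way, both ends included.
    The cleanings are listed, instead of being existentially quantified, so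
    that finite series can be chained into an infinite sequence. *)
Fixpoint cleans C v (l : seq (X * R)) v' : Prop := (weight v 0 <= C)%E /\
  if l is a :: l' then legal a /\ cleans C (clean v a) l' v' else v = v'.

Lemma nonnegD p q : nonneg p -> nonneg q -> nonneg (p \+ q).
Proof. by move=> p0 q0 x; rewrite addr_ge0. Qed.

Lemma nonneg_outside s p : nonneg p -> nonneg (outside s p).
Proof. by move=> p0 x; rewrite /outside; case: ifP. Qed.

Lemma nonneg_clean v a : legal a -> nonneg v -> nonneg (clean v a).
Proof.
move=> [_ /andP[a0 a1]] v0 y; rewrite /clean addr_ge0 ?mulr_ge0 ?(ltW a0) //.
by case: (_ == _); rewrite ?mulr1 ?mulr0 ?subr_ge0 // subr0.
Qed.

Lemma weight_ge0 v i : nonneg v -> (0 <= weight v i)%E.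
Proof. by move=> v0; apply: esum_ge0 => x _; rewrite mule_ge0 ?lee_fin. Qed.

Lemma weightD p q i : nonneg p -> nonneg q ->
  weight (p \+ q) i = (weight p i + weight q i)%E.
Proof.
move=> p0 q0; rewrite /weight -esumD.
- by apply: eq_esum => x _; rewrite /= EFinD ge0_muleDl ?lee_fin.
- by move=> x _; rewrite mule_ge0 ?lee_fin.
- by move=> x _; rewrite mule_ge0 ?lee_fin.
Qed.

Lemma weight0 i : weight (fun=> 0) i = 0%E.
Proof. by apply: esum1 => x _; rewrite mul0e. Qed.

Lemma weight_outside s p i :
  weight (outside s p) i =
  \esum_(x in [set: X]) (if x \in s then 0 else (p x)%:E * h i x)%E.
Proof.
by apply: eq_esum => x _; rewrite /outside; case: ifP; rewrite ?mul0e.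
Qed.

Lemma weight_outside_sub s s' p i : nonneg p -> {subset s <= s'} ->
  (weight (outside s' p) i <= weight (outside s p) i)%E.
Proof.
move=> p0 ss'; rewrite !weight_outside; apply: le_esum => x _.
have [/ss'->//|_] := boolP (x \in s).
by case: ifP => // _; rewrite mule_ge0 ?lee_fin.
Qed.

Lemma weight_outside_le s p i : nonneg p ->
  (weight (outside s p) i <= weight p i)%E.
Proof. by move=> p0; exact: (@weight_outside_sub [::]). Qed.

Lemma weight_outside1 x p i : nonneg p ->
  weight p i = ((p x)%:E * h i x + weight (outside [:: x] p) i)%E.
Proof.
move=> p0; rewrite weight_outside.
have -> : ((p x)%:E * h i x)%E = \esum_(y in [set: X])
    (if y == x then (p y)%:E * h i y else 0)%E.
  rewrite (@esum_only _ _ _ x) ?eqxx ?mule_ge0 ?lee_fin //.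
  by move=> y /negPf->.
rewrite -esumD.
- apply: eq_esum => y _; rewrite in_cons in_nil orbF.
  by case: eqP; rewrite ?adde0 ?add0e.
- by move=> y _; case: ifP => // _; rewrite mule_ge0 ?lee_fin.
- by move=> y _; case: ifP => // _; rewrite mule_ge0 ?lee_fin.
Qed.

(** Transporting mass out of a site of [L] along [alpha] shifts the index of
    the weights by one. *)
Lemma weight_fired x (t : R) i : L x -> 0 <= t ->
  weight (fun y => t * alpha x y) i = (t%:E * h i.+1 x)%E.
Proof.
move=> Lx t0; rewrite hS // -esumZ ?lee_fin //.
  by apply: eq_esum => y _; rewrite EFinM muleA.
by move=> y; rewrite mule_ge0 ?lee_fin.
Qed.

Lemma cleans_weight C v l v' : cleans C v l v' -> (weight v 0 <= C)%E.
Proof. by case: l => [|a l] []. Qed.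

Lemma cleans_cat C v l1 v1 l2 v2 : cleans C v l1 v1 -> cleans C v1 l2 v2 ->
  cleans C v (l1 ++ l2) v2.
Proof.
elim: l1 v => [|a l1 IH] v /=; first by move=> [_ ->].
by move=> [? [? c1]] c2; split=> //; split=> //; apply: IH.
Qed.

Lemma nonneg_cleanings (a : nat -> X * R) n v : (forall i, legal (a i)) ->
  nonneg v -> nonneg (foldl clean v (mkseq a n)).
Proof.
move=> la v0; elim: n => [|n IH] //.
by rewrite mkseqS -cats1 foldl_cat; apply: nonneg_clean.
Qed.

(** Cleaning a site [x] with proportion [t / v x] moves exactly the amount [t],
    so that prescribed amounts can be moved whatever mass arrived since. *)
Lemma cleans_amount C v x (t : R) :
  let v' := fun y => v y - t * (y == x)%:R + t * alpha x y in
  nonneg v -> L x -> 0 <= t <= v x ->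
  (weight v 0 <= C)%E -> (weight v' 0 <= C)%E ->
  exists l, cleans C v l v'.
Proof.
move=> v' v0 Lx /andP[t0 tv] vC v'C.
have [t_eq0|tN0] := eqVneq t 0.
  exists [::]; split=> //; apply/funext => y.
  by rewrite /v' t_eq0 !mul0r subr0 addr0.
have tgt0 : 0 < t by rewrite lt_neqAle eq_sym tN0.
have vx0 : 0 < v x by exact: lt_le_trans tv.
have cv' : clean v (x, t / v x) = v'.
  apply/funext => y; rewrite /clean /v' /= divfK ?gt_eqF //; congr (_ + _).
  have [->|_] := eqVneq y x; last by rewrite !mulr0 !subr0 mul1r.
  by rewrite !mulr1 mulrBl mul1r divfK ?gt_eqF.
exists [:: (x, t / v x)]; split=> //; split; last by rewrite cv'.
by split=> //=; rewrite divr_gt0 //= ler_pdivrMr // mul1r.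
Qed.

(** One generation on a finite set: the mass [p] on [s] is replaced by its
    image under [alpha], which is collected in [r']; [q] is left alone and [r]
    is what has been collected so far. The equality of weights says that
    nothing is lost: a site of [s] weighted by [h i.+1] becomes its
    image weighted by [h i]. *)
Lemma cleans_sweep C s q p r : (forall x, x \in s -> L x) ->
  nonneg q -> nonneg p -> nonneg r ->
  (weight q 0 + (weight p 0 + (weight p 1 + weight r 0)) <= C)%E ->
  exists l r', [/\ nonneg r',
    cleans C (q \+ (p \+ r)) l (q \+ (outside s p \+ r')) &
    forall i, (weight (outside s p) i.+1 + weight r' i =
               weight p i.+1 + weight r i)%E].
Proof.
elim: s p r => [|x s IH] p r Ls q0 p0 r0 leC.
  exists [::], r; split=> //; split=> //.
  rewrite !weightD //; last exact: nonnegD.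
  apply: le_trans leC; rewrite leeD2l // leeD2l // leeDr //.
  exact: weight_ge0.
have Lx : L x by apply: Ls; rewrite mem_head.
pose p1 := outside [:: x] p; pose r1 := r \+ (fun y => p x * alpha x y).
have p10 : nonneg p1 by exact: nonneg_outside.
have f0 : nonneg (fun y => p x * alpha x y) by move=> y; rewrite mulr_ge0.
have r10 : nonneg r1 by exact: nonnegD.
have w1 i : (weight p1 i.+1 + weight r1 i = weight p i.+1 + weight r i)%E.
  rewrite weightD // weight_fired // [weight p _](weight_outside1 x) //.
  by rewrite -addeA [RHS]addeC addeA.
have leC1 : (weight q 0 + (weight p1 0 + (weight p1 1 + weight r1 0)) <= C)%E.
  apply: le_trans leC; rewrite leeD2l // w1 leeD2r //.
  exact: weight_outside_le.
have Ls' : forall y, y \in s -> L y.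
  by move=> y ys; apply: Ls; rewrite in_cons ys orbT.
have [l' [r' [r'0 cl' w']]] := IH p1 r1 Ls' q0 p10 r10 leC1.
have out2 : outside s p1 = outside (x :: s) p.
  apply/funext => y; rewrite /p1 /outside !in_cons in_nil orbF.
  by case: (y == x); case: (y \in s).
have v1E : (fun y => (q \+ (p \+ r)) y - p x * (y == x)%:R + p x * alpha x y)
    = q \+ (p1 \+ r1).
  apply/funext => y; rewrite /r1 /p1 /outside /= in_cons in_nil orbF.
  have [->|_] := eqVneq y x; first by rewrite mulr1; ring.
  by rewrite mulr0; ring.
have [l cl] : exists l, cleans C (q \+ (p \+ r)) l (q \+ (p1 \+ r1)).
  rewrite -v1E; apply: cleans_amount => //.
  - by do 2 apply: nonnegD => //.
  - by rewrite p0 /= addrCA lerDl addr_ge0.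
  - rewrite !weightD //; last exact: nonnegD.
    apply: le_trans leC; rewrite leeD2l // leeD2l // leeDr //.
    exact: weight_ge0.
  - by rewrite v1E; exact: cleans_weight cl'.
exists (l ++ l'), r'; split=> //.
  by rewrite -out2; exact: cleans_cat cl cl'.
by move=> i; rewrite -out2 w' w1.
Qed.

Lemma vanishing_shift p q k : nonneg p -> nonneg q ->
  (forall i, weight p i <= weight q (i + k))%E -> vanishing q -> vanishing p.
Proof.
move=> p0 q0 pq [qfin qcvg]; split=> [i|]; first exact: le_lt_trans (qfin _).
have qk : (fun i => weight q (i + k)) @ \oo --> 0%E by rewrite (cvg_shiftn k).
apply: squeeze_cvge _ (cvg_cst 0%E) qk.
by apply: nearW => i; rewrite weight_ge0 /=.
Qed.

Lemma vanishing_le p q : nonneg p -> nonneg q ->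
  (forall i, weight p i <= weight q i)%E -> vanishing q -> vanishing p.
Proof.
by move=> p0 q0 pq; apply: (@vanishing_shift p q 0) => // i; rewrite addn0.
Qed.

Lemma vanishingD p q : nonneg p -> nonneg q ->
  vanishing p -> vanishing q -> vanishing (p \+ q).
Proof.
move=> p0 q0 [pfin pcvg] [qfin qcvg]; split=> [i|].
  by rewrite weightD // lte_add_pinfty.
rewrite (_ : weight (p \+ q) = weight p \+ weight q); last first.
  by apply/funext => i; rewrite weightD.
by rewrite -[0%E]adde0; apply: cvgeD.
Qed.

(** For large [i] the bound holds with no site removed because the weights
    tend to zero; each of the finitely many remaining [i] is a convergent sum
    with a small tail. *)
Lemma vanishing_tail p (e : R) : nonneg p -> vanishing p -> 0 < e ->
  exists2 s, (forall x, x \in s -> L x) &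
    forall i, (weight (outside s p) i <= e%:E)%E.
Proof.
move=> p0 [pfin pcvg] e0.
have wp0 i : (0 <= weight p i)%E by exact: weight_ge0.
have [N ltN] := (cvge0P wp0).1 pcvg e e0.
have [s sN] : exists s, forall i, (i < N)%N ->
    (weight (outside s p) i <= e%:E)%E.
  elim: N {ltN} => [|N [s sN]]; first by exists [::].
  have a0 x : (0 <= (p x)%:E * h N x)%E by rewrite mule_ge0 ?lee_fin.
  have [s' s'N] := esum_tail a0 (pfin N) e0.
  exists (s ++ s') => i; rewrite ltnS leq_eqVlt => /orP[/eqP->|/sN iN].
    move: s'N; rewrite -weight_outside; apply: le_trans.
    by apply: weight_outside_sub => // x xs; rewrite mem_cat xs orbT.
  by apply: le_trans iN; apply: weight_outside_sub => // x xs;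
    rewrite mem_cat xs.
exists [seq x <- s | `[< L x >]] => [x|i].
  by rewrite mem_filter => /andP[/asboolP].
have -> : weight (outside [seq x <- s | `[< L x >]] p) i =
    weight (outside s p) i.
  rewrite !weight_outside; apply: eq_esum => x _; rewrite mem_filter.
  by case: asboolP => //= Lx; case: ifP; rewrite h_off // mule0.
have [/sN//|Ni] := ltnP i N.
by apply: le_trans (ltN i Ni); exact: weight_outside_le.
Qed.

(** [k] sweeps in a row: the tail left behind by each sweep joins the residue
    [q] and is not touched again, and the error [e] is halved each time so that
    the tails add up to at most [e]. *)
Lemma cleans_generations k C q p (e : R) : nonneg q -> nonneg p ->
  vanishing q -> vanishing p -> 0 < e ->
  (forall i, weight q 0 + e%:E + (weight p i + weight p i.+1) <= C)%E ->
  exists l q' p', [/\ nonneg q' /\ nonneg p', vanishing q' /\ vanishing p',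
    cleans C (q \+ p) l (q' \+ p'),
    forall i, (weight q' i <= weight q i + e%:E)%E &
    forall i, (weight p' i <= weight p (i + k))%E].
Proof.
elim: k q p e => [|k IH] q p e q0 p0 vq vp e0 leC.
  exists [::], q, p; split=> //.
  - split=> //; rewrite weightD //; apply: le_trans (leC 0).
    apply: leeD; first by rewrite leeDl // lee_fin ltW.
    by rewrite leeDl // weight_ge0.
  - by move=> i; rewrite leeDl // lee_fin ltW.
  - by move=> i; rewrite addn0.
have e20 : 0 < e / 2 by rewrite divr_gt0.
have [s Ls tails] := vanishing_tail p0 vp e20.
pose z : X -> R := fun=> 0; have z0 : nonneg z by [].
have leC1 : (weight q 0 + (weight p 0 + (weight p 1 + weight z 0)) <= C)%E.
  rewrite weight0 adde0; apply: le_trans (leC 0).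
  by rewrite leeD2r // leeDl // lee_fin ltW.
have [l [r [r0 cl wr]]] := cleans_sweep Ls q0 p0 z0 leC1.
have o0 : nonneg (outside s p) by exact: nonneg_outside.
have vo : vanishing (outside s p).
  apply: (vanishing_le o0 p0) => // i; exact: weight_outside_le.
have rp i : (weight r i <= weight p (i + 1))%E.
  rewrite addn1 -[leRHS]adde0 -(weight0 i) -wr leeDr //; exact: weight_ge0.
have vr : vanishing r by exact: (vanishing_shift r0 p0 rp).
have qo0 : nonneg (q \+ outside s p) by exact: nonnegD.
have vqo : vanishing (q \+ outside s p) by exact: vanishingD.
have tail2 i : (weight (q \+ outside s p)%R i + (e / 2)%:E <=
    weight q i + e%:E)%E.
  by rewrite weightD // -addeA leeD2l // [e in leRHS]splitr EFinD leeD2r.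
have leC2 i : (weight (q \+ outside s p)%R 0 + (e / 2)%:E +
    (weight r i + weight r i.+1) <= C)%E.
  apply: le_trans (leC i.+1); apply: leeD; first exact: tail2.
  by have := leeD (rp i) (rp i.+1); rewrite !addn1.
have [l' [q' [p' [[q'0 p'0] [vq' vp'] cl' wq' wp']]]] :=
  IH _ _ _ qo0 r0 vqo vr e20 leC2.
exists (l ++ l'), q', p'; split=> //.
- apply: cleans_cat _ cl'.
  have -> : q \+ outside s p \+ r = q \+ (outside s p \+ r).
    by apply/funext => y /=; rewrite addrA.
  by move: cl; congr (cleans C _ l _); apply/funext => y /=; rewrite addr0.
- by move=> i; apply: le_trans (wq' i) _; exact: tail2.
- by move=> i; apply: le_trans (wp' i) _; rewrite addnS -addn1.
Qed.


(** The series starts with a complete cleaning of [x0], which ensures that it is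
    nonempty; this may at most double the bound [B], since it replaces a part
    of [v] by its image. Then [k] generations are moved, with [k] so large that
    what has moved [k] times is negligible in all future generations. *)
Lemma cleans_phase x0 v B (e : R) : L x0 -> nonneg v -> vanishing v ->
  (forall i, weight v i <= B)%E -> 0 < e ->
  exists a l v', [/\ nonneg v', vanishing v',
    cleans (B + B + (B + B) + e%:E)%E v (a :: l) v' &
    forall i, (weight v' i <= e%:E)%E].
Proof.
move=> Lx0 v0 vv vB e0.
pose o := outside [:: x0] v; pose f := fun y => v x0 * alpha x0 y.
have o0 : nonneg o by exact: nonneg_outside.
have f0 : nonneg f by move=> y; rewrite mulr_ge0.
have B0 : (0 <= B)%E by apply: le_trans (vB 0); exact: weight_ge0.
have oB i : (weight o i <= weight v i)%E by exact: weight_outside_le.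
have fB i : (weight f i <= weight v (i + 1))%E.
  rewrite addn1 weight_fired // (weight_outside1 x0) // leeDl //.
  exact: weight_ge0.
have v1E : clean v (x0, 1) = o \+ f.
  apply/funext => y; rewrite /clean /o /f /outside /= in_cons in_nil orbF.
  have [->|_] := eqVneq y x0; first by rewrite mulr1 subrr mul0r mul1r.
  by rewrite mulr0 subr0 !mul1r.
have of0 : nonneg (o \+ f) by exact: nonnegD.
have vof : vanishing (o \+ f).
  apply: vanishingD => //; first exact: vanishing_le oB vv.
  exact: vanishing_shift fB vv.
have ofB i : (weight (o \+ f)%R i <= B + B)%E.
  by rewrite weightD // leeD // ?(le_trans (oB i)) ?(le_trans (fB i)).
have e20 : 0 < e / 2 by rewrite divr_gt0.
have w0 i : (0 <= weight (o \+ f)%R i)%E by exact: weight_ge0.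
have [k lek] := (cvge0P w0).1 vof.2 _ e20.
pose z : X -> R := fun=> 0; have z0 : nonneg z by [].
have vz : vanishing z.
  by apply: (vanishing_le z0 v0) vv => i; rewrite weight0 weight_ge0.
have leC i : (weight z 0 + (e / 2)%:E +
    (weight (o \+ f)%R i + weight (o \+ f)%R i.+1) <=
    B + B + (B + B) + e%:E)%E.
  rewrite weight0 add0e [leLHS]addeC; apply: leeD.
    exact: leeD (ofB _) (ofB _).
  by rewrite lee_fin; lra.
have [l [q [p [[q0 p0] [vq vp] cl wq wp]]]] :=
  cleans_generations k z0 of0 vz vof e20 leC.
exists (x0, 1), l, (q \+ p); split.
- exact: nonnegD.
- exact: vanishingD.
- split.
    apply: le_trans (vB 0) _.
    by rewrite -!addeA leeDl // !adde_ge0 // lee_fin ltW.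
  split; first by split=> //=; rewrite ltr01 lexx.
  by rewrite v1E; move: cl; congr cleans; apply/funext => y /=; rewrite add0r.
- move=> i; rewrite weightD // [e in leRHS]splitr EFinD leeD //.
    by apply: le_trans (wq i) _; rewrite weight0 add0e.
  by apply: le_trans (wp i) _; rewrite lek // leq_addl.
Qed.

(** No bound is prescribed for the vector from which the first phase starts. *)
Definition phase_bound k : \bar R :=
  if k is k'.+1 then ((k'.+1)%:R^-1)%:E else +oo%E.

Let reached k v := [/\ nonneg v, vanishing v &
  forall i, (weight v i <= phase_bound k)%E].

Let cap k := (phase_bound k + phase_bound k + (phase_bound k + phase_bound k)
  + phase_bound k.+1)%E.

Lemma cap_small (e : R) : 0 < e ->
  exists K, forall k, (K <= k)%N -> (cap k <= e%:E)%E.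
Proof.
move=> e0; exists (Num.bound (5 / e)).+1 => -[|k] //; rewrite ltnS => Kk.
rewrite /cap /phase_bound -!EFinD lee_fin.
have k0 : 0 < k.+1%:R :> R by rewrite ltr0n.
have le5 : 5 / e <= k.+1%:R.
  apply: le_trans (ltW (archi_boundP _)) _; first by rewrite divr_ge0 ?ltW.
  by rewrite ler_nat (leq_trans Kk).
have leS : k.+2%:R^-1 <= k.+1%:R^-1 :> R.
  by rewrite lef_pV2 ?posrE ?ltr0n ?ler_nat.
have : 5 * k.+1%:R^-1 <= e.
  by rewrite ler_pdivrMr // mulrC -ler_pdivrMr.
move: leS; move: (k.+1%:R^-1) (k.+2%:R^-1) => x y leyx le5x.
lra.
Qed.

(** The phases are run one after another by a machine that stores what is left
    of the current phase. A phase is finite, so the phase number tends to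
    infinity, and with it the bound on the weight tends to 0. *)
Lemma cleaning_sequence v : L !=set0 -> nonneg v -> vanishing v ->
  exists2 a : nat -> X * R, forall n, legal (a n) &
    (fun n => weight (foldl clean v (mkseq a n)) 0) @ \oo --> 0%E.
Proof.
move=> [x0 Lx0] v0 vv.
have phase (kv : nat * (X -> R)) : exists al : (X * R) * seq (X * R),
    reached kv.1 kv.2 -> exists v', cleans (cap kv.1) kv.2 (al.1 :: al.2) v' /\
      reached kv.1.+1 v'.
  case: kv => k u /=.
  have [[u0 vu uB]|nr] := pselect (reached k u); last by exists ((x0, 1), [::]).
  have k0 : 0 < k.+1%:R^-1 :> R by rewrite invr_gt0 ltr0n.
  have [a [l [v' [v'0 vv' cl v'B]]]] := cleans_phase Lx0 u0 vu uB k0.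
  by exists (a, l) => _; exists v'.
have [plan planP] := choice phase.
(* A state is the number of the phase, the current vector and the cleanings
   that remain in this phase. *)
pose state : Type := (nat * (X -> R) * seq (X * R))%type.
pose unfold (st : state) : nat * (X -> R) * ((X * R) * seq (X * R)) :=
  let: (k, u, l) := st in
  if l is a :: l' then (k, u, (a, l')) else (k.+1, u, plan (k.+1, u)).
pose next (st : state) : state :=
  let: (k, u, (a, l)) := unfold st in (k, clean u a, l).
pose action st := (unfold st).2.1.
pose inv (st : state) := let: (k, u, l) := st in
  exists v', cleans (cap k) u l v' /\ reached k.+1 v'.
have inv_next st : inv st -> legal (action st) /\ inv (next st).
  case: st => -[k u] [|a l]; rewrite /inv /next /action /=.
    move=> [_ [[_ <-]] ru].
    have [v' [cl rv']] := planP (k.+1, u) ru.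
    case: (plan (k.+1, u)) cl => a l /= [_ [la cl]].
    by split=> //; exists v'.
  by move=> [v' [[_ [la cl]] rv']]; split=> //; exists v'.
have next_vec st : (next st).1.2 = clean st.1.2 (action st).
  by case: st => -[k u] [|a l]; rewrite /next /action //=; case: (plan _).
have next_ge st : (st.1.1 <= (next st).1.1)%N.
  by case: st => -[k u] [|a l]; rewrite /next //=; case: (plan _) => /=.
have progress st : exists m, (st.1.1 < (iter m next st).1.1)%N.
  case: st => -[k u] l; elim: l u => [|a l IH] u.
    by exists 1; rewrite /= /next /=; case: (plan _).
  by have [m ltm] := IH (clean u a); exists m.+1; rewrite iterSr.
pose st n := iter n next (0, v, (plan (0, v)).1 :: (plan (0, v)).2).
have st_inv n : inv (st n).
  elim: n => [|n IH]; last by have [] := inv_next _ IH.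
  by apply: (planP (0, v)); split=> // i; rewrite /= leey.
have unbounded K : exists n, (K <= (st n).1.1)%N.
  elim: K => [|K [n Kn]]; first by exists 0.
  have [m ltm] := progress (st n); exists (m + n)%N.
  by rewrite /st iterD; exact: leq_ltn_trans ltm.
have st_ge n m : (n <= m)%N -> ((st n).1.1 <= (st m).1.1)%N.
  move=> /subnK <-; elim: (m - n)%N => [|d IH] //.
  exact: leq_trans IH (next_ge _).
have st_vec n : foldl clean v (mkseq (action \o st) n) = (st n).1.2.
  elim: n => [|n IH] //; rewrite mkseqS -cats1 foldl_cat IH /=.
  by rewrite next_vec.
have la n : legal ((action \o st) n) by have [] := inv_next _ (st_inv n).
exists (action \o st) => //.
apply/cvge0P => [n|e e0]; first exact/weight_ge0/nonneg_cleanings.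
have [K capK] := cap_small e0; have [N KN] := unbounded K.
exists N => n Nn; rewrite st_vec.
have := st_inv n; have := capK _ (leq_trans KN (st_ge _ _ Nn)).
case: (st n) => -[k u] l /= lee [v' [cl _]].
exact: le_trans (cleans_weight cl) lee.
Qed.

End Cleaning.

(** * Matrix products *)

Section Matrices.
Variables (R : realType) (X : countType).
Implicit Types (c w : evec R X) (A B M : emx R X) (f v : X -> R).

Local Notation nonneg_vec c := (forall x, 0 <= c x)%E.
Local Notation nonneg_mx A := (forall x y, 0 <= A x y)%E.

Lemma dotev_mulvemx c M w : nonneg_vec c -> nonneg_mx M -> nonneg_vec w ->
  dotev (mulvemx c M) w = dotev c (fun x => dotev (M x) w).
Proof.
move=> c0 M0 w0; rewrite /dotev /mulvemx.
transitivity (\esum_(y in [set: X]) \esum_(x in [set: X])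
    (c x * (M x y * w y))%E).
  apply: eq_esum => y _; rewrite muleC -esumZ //.
    by apply: eq_esum => x _; rewrite muleC muleA.
  by move=> x; exact: mule_ge0.
rewrite exchange_esum; last by move=> y x; rewrite !mule_ge0.
by apply: eq_esum => x _; rewrite esumZ // => y; exact: mule_ge0.
Qed.

Lemma mulvemxA c A B : nonneg_vec c -> nonneg_mx A -> nonneg_mx B ->
  mulvemx (mulvemx c A) B = mulvemx c (mulemx A B).
Proof.
by move=> c0 A0 B0; apply/funext => y; exact: (@dotev_mulvemx _ _ (B^~ y)).
Qed.

Lemma mulemx_ge0 A B : nonneg_mx A -> nonneg_mx B -> nonneg_mx (mulemx A B).
Proof. by move=> A0 B0 x y; apply: esum_ge0 => z _; exact: mule_ge0. Qed.

Lemma diagemx_ge0 f : (forall x, 0 <= f x) -> nonneg_mx (diagemx f).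
Proof. by move=> f0 x y; rewrite lee_fin mulr_ge0. Qed.

Lemma mulvemx_diag c f : nonneg_vec c -> (forall x, 0 <= f x) ->
  mulvemx c (diagemx f) = (fun y => c y * (f y)%:E)%E.
Proof.
move=> c0 f0; apply/funext => y; rewrite /mulvemx /diagemx.
rewrite (@esum_only _ _ _ y) ?eqxx ?mulr1 ?mule_ge0 ?lee_fin //.
by move=> x /negPf->; rewrite mulr0 mule0.
Qed.

Lemma mulemx_diag A f : nonneg_mx A -> (forall x, 0 <= f x) ->
  mulemx A (diagemx f) = (fun x y => A x y * (f y)%:E)%E.
Proof. by move=> A0 f0; apply/funext => x; exact: (mulvemx_diag (A0 x)). Qed.

Lemma diag_mulemx f A : nonneg_mx A -> (forall x, 0 <= f x) ->
  mulemx (diagemx f) A = (fun x y => (f x)%:E * A x y)%E.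
Proof.
move=> A0 f0; apply/funext => x; apply/funext => y; rewrite /mulemx /diagemx.
rewrite (@esum_only _ _ _ x) ?eqxx ?mulr1 ?mule_ge0 ?lee_fin //.
by move=> z zx; rewrite eq_sym (negPf zx) mulr0 mul0e.
Qed.

Variables (alpha : X -> X -> R) (L : set X).
Hypothesis alpha_ge0 : forall x y, 0 <= alpha x y.

Local Notation cleaning_of a :=
  (cleaning alpha (fun z => a.2 * \1_[set a.1] z)).

Lemma delta_indic (x z : X) : \1_[set x] z = (z == x)%:R :> R.
Proof.
rewrite indicE; congr (_ %:R); congr nat_of_bool.
by apply/idP/eqP; rewrite in_setE.
Qed.

Lemma cleaning_ge0 a : legal L a -> nonneg_mx (cleaning_of a).
Proof.
move=> [_ /andP[a0 a1]] x y; rewrite /cleaning /addemx diag_mulemx.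
- rewrite adde_ge0 ?mule_ge0 ?lee_fin ?mulr_ge0 ?(ltW a0) //.
  by rewrite delta_indic; case: (_ == _); rewrite ?mulr1 ?mulr0 subr_ge0.
- by move=> ? ?; rewrite lee_fin.
- by move=> z; rewrite mulr_ge0 // ltW.
Qed.

Lemma mulvemx_cleaning v a : legal L a -> (forall x, 0 <= v x) ->
  mulvemx (evec_of v) (cleaning_of a) = evec_of (clean alpha v a).
Proof.
move=> [_ /andP[a0 a1]] v0; set f := (fun z => _).
have f0 x : 0 <= f x by rewrite /f mulr_ge0 // ltW.
have f1 x : 0 <= 1 - f x.
  by rewrite /f delta_indic; case: (_ == _); rewrite ?mulr1 ?mulr0 ?subr_ge0.
have d0 x y : (0 <= diagemx (fun x => 1 - f x)%R x y)%E by exact: diagemx_ge0.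
have m0 x y : (0 <= (f x)%:E * emx_of alpha x y)%E by rewrite mule_ge0 ?lee_fin.
have vE0 x : (0 <= evec_of v x)%E by rewrite lee_fin.
have aE0 x y : (0 <= emx_of alpha x y)%E by rewrite lee_fin.
apply/funext => y; rewrite /mulvemx /cleaning /addemx diag_mulemx //.
transitivity (\esum_(x in [set: X])
    (evec_of v x * diagemx (fun x => 1 - f x)%R x y +
     evec_of v x * ((f x)%:E * emx_of alpha x y))%E).
  by apply: eq_esum => x _; rewrite ge0_muleDr.
rewrite esumD; [|by move=> x _; rewrite mule_ge0..].
rewrite -[X in (X + _)%E]/(mulvemx (evec_of v) _ y) mulvemx_diag //.
rewrite (@esum_only _ _ _ a.1) ?mule_ge0 ?lee_fin //; last first.
  by move=> x /negPf xa; rewrite /f delta_indic xa mulr0 mul0e mule0.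
rewrite /evec_of /emx_of -!EFinM -EFinD; congr (_%:E).
rewrite /f !delta_indic eqxx mulr1 /clean; congr (_ + _); first by rewrite mulrC.
by rewrite mulrCA mulrA.
Qed.

Lemma prod_cleaning_ge0 (a : nat -> X * R) n : (forall i, legal L (a i)) ->
  nonneg_mx (\big[@mulemx R X/idemx]_(i < n) cleaning_of (a i)).
Proof.
move=> la; elim/big_ind: _ => [|A B A0 B0|i _].
- exact: diagemx_ge0.
- exact: mulemx_ge0.
- exact: cleaning_ge0.
Qed.

(** The first factor is split off and absorbed into the row vector, because
    associativity holds for nonnegative matrices only. *)
Lemma mulvemx_prod_cleaning (a : nat -> X * R) n v :
  (forall i, legal L (a i)) -> (forall x, 0 <= v x) ->
  mulvemx (evec_of v) (\big[@mulemx R X/idemx]_(i < n) cleaning_of (a i)) =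
  evec_of (foldl (clean alpha) v (mkseq a n)).
Proof.
elim: n a v => [|n IH] a v la v0.
  rewrite big_ord0 mulvemx_diag //.
  by apply/funext => y; rewrite mule1.
pose a' i := a i.+1; have la' i : legal L (a' i) by exact: la.
rewrite big_ord_recl.
under eq_bigr do rewrite lift0 -/(a' _).
rewrite -mulvemxA; last 3 first.
- by move=> x; rewrite lee_fin.
- exact: cleaning_ge0.
- exact: prod_cleaning_ge0.
rewrite mulvemx_cleaning // IH //; last by exact: nonneg_clean (la 0) v0.
by rewrite /mkseq /= (iotaDl 1 0) -map_comp.
Qed.

End Matrices.

(** * Powers of the restricted matrix *)

Section Potentials.
Variables (R : realType) (X : countType) (alpha : X -> X -> R) (L : set X).
Hypothesis alpha_ge0 : forall x y, 0 <= alpha x y.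
Variable w : X -> R.
Hypothesis w_ge0 : forall x, 0 <= w x.

Definition inner : emx R X :=
  mulemx (mulemx (restr L) (emx_of alpha)) (restr L).

(** The factor [\1_L x] makes the mass that has left [L] weightless already at
    [k = 0], where the power is the identity matrix. *)
Definition potential k x : \bar R :=
  ((\1_L x)%:E * dotev (expemx inner k x) (evec_of w))%E.

Let alphaE0 x y : (0 <= emx_of alpha x y)%E. Proof. by rewrite lee_fin. Qed.

Let wE0 x : (0 <= evec_of w x)%E. Proof. by rewrite lee_fin. Qed.

Let indic0 x : 0 <= \1_L x :> R. Proof. by []. Qed.

Lemma innerE x y :
  inner x y = ((\1_L x)%:E * (alpha x y)%:E * (\1_L y)%:E)%E.
Proof.
rewrite /inner /restr diag_mulemx // mulemx_diag // => z t.
by rewrite mule_ge0 ?lee_fin.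
Qed.

Lemma inner_ge0 x y : (0 <= inner x y)%E.
Proof. by rewrite innerE !mule_ge0 ?lee_fin. Qed.

Lemma expemx_inner_ge0 k x y : (0 <= expemx inner k x y)%E.
Proof.
elim: k x y => [|k IH] x y; first exact: diagemx_ge0.
by apply: mulemx_ge0 => //; exact: inner_ge0.
Qed.

Let dot0 k x : (0 <= dotev (expemx inner k x) (evec_of w))%E.
Proof. by apply: esum_ge0 => y _; rewrite mule_ge0 ?expemx_inner_ge0. Qed.

Lemma potential_ge0 k x : (0 <= potential k x)%E.
Proof. by rewrite mule_ge0 ?lee_fin. Qed.

Lemma potential_off k x : ~ L x -> potential k x = 0%E.
Proof. by move=> nLx; rewrite /potential indicE memNset // mul0e. Qed.

Lemma potential0 x : potential 0 x = ((\1_L x)%:E * (w x)%:E)%E.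
Proof.
rewrite /potential; congr (_ * _)%E; rewrite /dotev /= /idemx /diagemx.
rewrite (@esum_only _ _ _ x) ?eqxx ?mulr1 ?mul1e ?lee_fin //.
by move=> y yx; rewrite eq_sym (negPf yx) mulr0 mul0e.
Qed.

Lemma potentialS k x : L x ->
  potential k.+1 x = \esum_(y in [set: X]) ((alpha x y)%:E * potential k y)%E.
Proof.
move=> Lx; rewrite {1}/potential indicE mem_set // mul1e.
rewrite -[expemx _ _ x]/(mulvemx (inner x) (expemx inner k)).
rewrite dotev_mulvemx //; [|exact: inner_ge0|exact: expemx_inner_ge0].
apply: eq_esum => y _; rewrite innerE indicE mem_set // mul1e.
by rewrite /potential muleA.
Qed.

Lemma weight_potential_le (c : X -> R) k : (forall x, 0 <= c x) ->
  (weight potential c k <= sandwich c (expemx inner k) w)%E.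
Proof.
move=> c0; rewrite /sandwich dotev_mulvemx //; last exact: expemx_inner_ge0.
apply: le_esum => x _; apply: lee_wpmul2l; first by rewrite lee_fin.
rewrite /potential indicE; case: (x \in L); first by rewrite mul1e.
by rewrite mul0e.
Qed.

Lemma sandwich_prod_cleaning (a : nat -> X * R) n (c : X -> R) :
  (forall i, legal L (a i)) -> (forall x, 0 <= c x) ->
  sandwich c (mulemx (\big[@mulemx R X/idemx]_(i < n)
      cleaning alpha (fun z => (a i).2 * \1_[set (a i).1] z)) (restr L)) w =
  weight potential (foldl (clean alpha) c (mkseq a n)) 0.
Proof.
move=> la c0; set v := foldl _ _ _.
have v0 x : 0 <= v x by exact: (nonneg_cleanings _ _ la).
have MC : forall x y, _ := prod_cleaning_ge0 alpha_ge0 n la.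
rewrite /sandwich -mulvemxA //.
- rewrite (mulvemx_prod_cleaning alpha_ge0 n la c0) -/v /restr mulvemx_diag //.
  apply: eq_esum => x _.
  by rewrite potential0 muleA.
- exact: diagemx_ge0.
Qed.

End Potentials.

Theorem theorem5p4 (R : realType) (X : countType) (hX : [set: X] !=set0)
    (alpha : X -> X -> R) (halpha : forall x y : X, 0 <= alpha x y)
    (L : set X) (hL : L !=set0)
    (c w : X -> R) (hc : forall x : X, 0 <= c x) (hw : forall x : X, 0 <= w x)
    (ha : forall k : nat,
      (sandwich c
        (expemx (mulemx (mulemx (restr L) (emx_of alpha)) (restr L)) k) w
       < +oo)%E)
    (hb : (fun k : nat =>
        sandwich c
          (expemx (mulemx (mulemx (restr L) (emx_of alpha)) (restr L)) k) w)
      @ \oo --> 0%E) :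
  exists (x : nat -> X) (eps : nat -> R),
    [/\ forall n : nat, L (x n),
        forall n : nat, 0 < eps n <= 1
      & (fun n : nat =>
          sandwich c
            (mulemx
              (\big[@mulemx R X/idemx]_(i < n)
                 cleaning alpha (fun z => eps i * \1_[set x i] z))
              (restr L)) w)
        @ \oo --> 0%E].
Proof.
have h0 := potential_ge0 L halpha hw.
have hoff := potential_off alpha w (L := L).
have hS := potentialS halpha hw (L := L).
have vc : vanishing (potential alpha L w) c.
  have le k := weight_potential_le L halpha hw k hc.
  split=> [k|]; first exact: le_lt_trans (le k) (ha k).
  apply: squeeze_cvge _ (cvg_cst 0%E) hb.
  by apply: nearW => k; rewrite weight_ge0 //= le.
have [a la cvg0] := cleaning_sequence halpha h0 hoff hS hL hc vc.
exists (fun n => (a n).1), (fun n => (a n).2); split=> [n|n|].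
- by have [] := la n.
- by have [] := la n.
- have -> // := funext (fun n => sandwich_prod_cleaning halpha hw n la hc).
Qed.
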